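(* One has $\mathscr{M}_{n,d}=\frac{\log n}{\pi}+O(1)$ for $d>16\,n\log n$ and $n\to\infty$; that is, there exist absolute constants $C>0$ and $N\ge 1$ such that for all integers $n\ge N$ and all integers $d$ with $d>16\,n\log n$, $$\left|\mathscr{M}_{n,d}-\frac{\log n}{\pi}\right|\le C.$$
   Context: For a function $f$ on the open complex unit disk $\mathbb{D}$, $\|f\|_\infty=\sup\{|f(z)|: z\in\mathbb{D}\}$. For integers $d>n\ge 0$, $\mathscr{M}_{n,d}$ denotes the maximum of $|a_0+a_1+\dots+a_n|$ over all polynomials $f=a_0+a_1X+\dots+a_{d-1}X^{d-1}\in\mathbb{C}[X]$ of degree strictly less than $d$ with $\|f\|_\infty\le 1$. Here $\log$ is the natural logarithm. *)

(* Defs.v *)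
From HB Require Import structures.
From mathcomp Require Import all_boot all_order all_algebra.
From mathcomp Require Import complex.
From mathcomp Require Import all_classical all_reals all_analysis.

Set Implicit Arguments.
Unset Strict Implicit.
Unset Printing Implicit Defensive.

Import Order.TTheory GRing.Theory Num.Theory.
Import numFieldNormedType.Exports.
Import ComplexField.Normc.

Local Open Scope classical_set_scope.
Local Open Scope complex_scope.
Local Open Scope ring_scope.

Definition unit_disk (R : realType) : set R[i] := [set z | normc z < 1].
Arguments unit_disk : clear implicits.

(* Extended-real valued, since f may be unbounded on the disk. *)
Definition disk_norm (R : realType) (f : R[i] -> R[i]) : \bar R :=
  ereal_sup [set (normc (f z))%:E | z in unit_disk R].

Definition coef_sums (R : realType) (n d : nat) : set R :=
  [set normc (\sum_(i < n.+1) f`_i) | f in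
    [set f : {poly R[i]} | (size f <= d)%N /\
                           (disk_norm (horner f) <= 1)%E]].
Arguments coef_sums : clear implicits.

(* The supremum is attained, so this is the maximum: see [max_coef_sumP].
   [size f <= d] means degree strictly less than d, the zero polynomial being
   included; [f`_i] is 0 for i >= d, so the definition is total in n and d. *)
Definition max_coef_sum (R : realType) (n d : nat) : R := sup (coef_sums R n d).
Arguments max_coef_sum : clear implicits.

Section Attained.
Variable R : realType.
Implicit Types (n d : nat) (f : {poly R[i]}) (z : R[i]).

Lemma normc_ge0 z : 0 <= normc z.
Proof. by case: z => a b; exact: sqrtr_ge0. Qed.

Lemma disk_norm_le1P f :
  (disk_norm (horner f) <= 1)%E <->
  forall z, unit_disk R z -> normc f.[z] <= 1.
Proof.
split=> [f1 z zD|fD].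
  by rewrite -lee_fin; apply: le_trans f1; apply: ereal_sup_ubound; exists z.
by apply: ge_ereal_sup => _ [z zD <-]; rewrite lee_fin; exact: fD.
Qed.

Lemma le_normc_sum (I : finType) (P : pred I) (F : I -> R[i]) :
  normc (\sum_(i | P i) F i) <= \sum_(i | P i) normc (F i).
Proof.
elim/big_ind2: _ => [|x a y b xa yb|//]; first by rewrite normc0.
by apply: le_trans (le_normcD a b) _; exact: lerD.
Qed.

(* Polynomials of degree less than d, as points of R^(2d). *)
Let cf d (v : 'rV[R]_(d + d)) (i : 'I_d) : R[i] :=
  v 0 (lshift d i) +i* v 0 (rshift d i).
Let pol d (v : 'rV[R]_(d + d)) : {poly R[i]} :=
  \sum_(i < d) (cf v i)%:P * 'X^i.
Let vec d f : 'rV[R]_(d + d) :=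
  row_mx (\row_(i < d) complex.Re f`_i) (\row_(i < d) complex.Im f`_i).

Let polE d (v : 'rV[R]_(d + d)) k :
  (pol v)`_k = \sum_(i < d) cf v i * (k == i)%:R.
Proof. by rewrite coef_sum; apply: eq_bigr => i _; rewrite coefCM coefXn. Qed.

Let size_pol d (v : 'rV[R]_(d + d)) : (size (pol v) <= d)%N.
Proof.
apply/leq_sizeP => k dk; rewrite polE big1// => i _.
by rewrite gtn_eqF ?mulr0// (leq_trans (ltn_ord i) dk).
Qed.

Let vecK d f : (size f <= d)%N -> pol (vec d f) = f.
Proof.
move=> fd; apply/polyP => k; rewrite polE.
have [kd|dk] := ltnP k d; last first.
  rewrite nth_default ?(leq_trans fd)// big1// => i _.
  by rewrite gtn_eqF ?mulr0// (leq_trans (ltn_ord i) dk).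
rewrite (bigD1 (Ordinal kd))//= eqxx mulr1 big1 ?addr0; last first.
  by move=> i; rewrite -val_eqE/= eq_sym => /negPf ->; rewrite mulr0.
by rewrite /cf row_mxEl row_mxEr !mxE/=; case: f`_k.
Qed.

Let horner_pol d (v : 'rV[R]_(d + d)) z :
  (pol v).[z] = \sum_(i < d) cf v i * z ^+ i.
Proof.
by rewrite horner_sum; apply: eq_bigr => i _; rewrite hornerCM hornerXn.
Qed.

Let continuous_form d (w : 'I_d -> R[i]) :
  continuous (fun v : 'rV[R]_(d + d) => normc (\sum_(i < d) cf v i * w i)).
Proof.
have -> : (fun v : 'rV[R]_(d + d) => normc (\sum_(i < d) cf v i * w i)) =
  (fun v : 'rV[R]_(d + d) => Num.sqrt
    ((\sum_(i < d) (v 0 (lshift d i) * complex.Re (w i) -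
                    v 0 (rshift d i) * complex.Im (w i))) ^+ 2 +
     (\sum_(i < d) (v 0 (lshift d i) * complex.Im (w i) +
                    v 0 (rshift d i) * complex.Re (w i))) ^+ 2)).
  apply/funext => v.
  have -> : \sum_(i < d) cf v i * w i =
    (\sum_(i < d) (v 0 (lshift d i) * complex.Re (w i) -
                    v 0 (rshift d i) * complex.Im (w i))) +i*
    (\sum_(i < d) (v 0 (lshift d i) * complex.Im (w i) +
                    v 0 (rshift d i) * complex.Re (w i))).
    apply: (big_ind3 (fun x a b => x = a +i* b)) => //.
      by move=> x a b y c e -> ->.
    by move=> i _; case: (w i).
  by [].
move=> v; set G := (X in continuous_at v (fun u => Num.sqrt (X u))).
suff Gc : {for v, continuous G}.
  exact: (continuous_comp Gc (@sqrt_continuous R (G v))).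
rewrite /G.
have cM j (c : R) : {for v, continuous (fun u : 'rV[R]_(d + d) => u 0 j * c)}.
  apply: continuousM; last exact: cst_continuous.
  exact: (@coord_continuous R 1 _ 0 j).
have cX (g : 'rV[R]_(d + d) -> R) : {for v, continuous g} ->
    {for v, continuous (fun u => g u ^+ 2)}.
  by move=> gc; exact: (continuousM gc gc).
have cS (g : 'I_d -> 'rV[R]_(d + d) -> R) :
    (forall i, {for v, continuous (g i)}) ->
    {for v, continuous (fun u => \sum_(i < d) g i u)}.
  move=> gc; elim: (index_enum _) => [|i r IH].
    rewrite (_ : (fun u => _) = cst 0); first exact: cst_continuous.
    by apply/funext => u; rewrite big_nil.
  rewrite (_ : (fun u => _) = fun u => g i u + \sum_(i <- r) g i u).
    exact: continuousD (gc i) IH.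
  by apply/funext => u; rewrite big_cons.
apply: continuousD; apply: cX; apply: cS => i.
  by apply: continuousB; exact: cM.
by apply: continuousD; exact: cM.
Qed.

Let feasible d : set 'rV[R]_(d + d) :=
  [set v | forall z, unit_disk R z -> normc (pol v).[z] <= 1].

Let closed_feasible d : closed (@feasible d).
Proof.
have -> : @feasible d = \bigcap_(z in unit_disk R)
    (fun v : 'rV[R]_(d + d) => normc (\sum_(i < d) cf v i * z ^+ i)) @^-1`
      [set x | x <= 1].
  by apply/seteqP; split=> v h z /h; rewrite /= horner_pol.
apply: closed_bigI => z _; apply: preimage_closed; last exact: closed_le.
by move=> v _; exact: continuous_form.
Qed.

(* Interpolation at d points of the disk bounds the coefficients. *)
Let bounded_feasible d : bounded_set (@feasible d).
Proof.
pose x : 'rV[R[i]]_d := \row_(j < d) ((j%:R / d.+1%:R : R)%:C).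
pose V := Vandermonde d x.
have Vu : V \in unitmx.
  rewrite unitmxE det_Vandermonde unitfE; apply/prodf_neq0 => i _.
  apply/prodf_neq0 => j ij; rewrite !mxE subr_eq0.
  rewrite (inj_eq (@complexI _)) (inj_eq (mulIf _)) ?invr_eq0 ?pnatr_eq0//.
  by rewrite eqr_nat gtn_eqF.
have xD j : unit_disk R (x 0 j).
  rewrite /unit_disk/= mxE/= expr0n/= addr0 sqrtr_sqr ger0_norm ?divr_ge0//.
  by rewrite ltr_pdivrMr// mul1r ltr_nat ltnS ltnW.
pose B := \sum_i \sum_j normc (invmx V j i).
have cfB (v : 'rV[R]_(d + d)) i : feasible v -> normc (cf v i) <= B.
  move=> vF; pose a : 'rV[R[i]]_d := \row_j cf v j.
  have aV : a *m V = \row_j (pol v).[x 0 j].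
    apply/rowP => j; rewrite !mxE horner_pol; apply: eq_bigr => k _.
    by rewrite !mxE.
  have -> : cf v i = \sum_j (pol v).[x 0 j] * invmx V j i.
    have -> : cf v i = (a *m V *m invmx V) 0 i by rewrite mulmxK// mxE.
    by rewrite aV mxE; apply: eq_bigr => j _; rewrite [in LHS]mxE.
  apply: le_trans (le_normc_sum _ _) _.
  apply: (@le_trans _ _ (\sum_j normc (invmx V j i))); last first.
    rewrite [leRHS](bigD1 i)//= lerDl.
    by apply: sumr_ge0 => k _; apply: sumr_ge0 => j _; exact: normc_ge0.
  apply: ler_sum => j _; rewrite normcM ler_piMl ?normc_ge0//.
  exact: vF (xD j).
have leRe (z : R[i]) : `|complex.Re z| <= normc z.
  by case: z => a b /=; rewrite -sqrtr_sqr ler_wsqrtr// lerDl sqr_ge0.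
have leIm (z : R[i]) : `|complex.Im z| <= normc z.
  by case: z => a b /=; rewrite -sqrtr_sqr ler_wsqrtr// lerDr sqr_ge0.
have B0 : 0 <= B.
  by apply: sumr_ge0 => k _; apply: sumr_ge0 => j _; exact: normc_ge0.
exists B; split; first exact: num_real.
move=> y By v vF; apply: le_trans (ltW By).
rewrite [leLHS]/Num.norm/= mx_normrE; apply: bigmax_le => // -[k j] _ /=.
rewrite ord1 -(splitK j); case: (fintype.split j) => i /=.
  exact: le_trans (leRe (cf v i)) (cfB v i vF).
exact: le_trans (leIm (cf v i)) (cfB v i vF).
Qed.

Lemma max_coef_sumP n d :
  coef_sums R n d (max_coef_sum R n d) /\
  ubound (coef_sums R n d) (max_coef_sum R n d).
Proof.
pose F (v : 'rV[R]_(d + d)) := normc (\sum_(k < n.+1) (pol v)`_k).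
have FE : F = fun v => normc (\sum_(i < d) cf v i *
    \sum_(k < n.+1) ((k : nat) == i)%:R).
  apply/funext => v; rewrite /F; congr normc.
  under eq_bigr do rewrite polE.
  by rewrite exchange_big; apply: eq_bigr => i _; rewrite mulr_sumr.
have [c cF cmax] : exists2 c, c \in @feasible d &
    forall t, t \in @feasible d -> F t <= F c.
  apply: EVT_max_rV.
  - exists 0 => z _; rewrite horner_pol big1 ?normc0// => i _.
    by rewrite /cf !mxE mul0r.
  - apply: bounded_closed_compact; [exact: bounded_feasible|].
    exact: closed_feasible.
  - by apply: continuous_subspaceT; rewrite FE; exact: continuous_form.
have Sc : coef_sums R n d (F c).
  exists (pol c) => //; split; first exact: size_pol.
  by apply/disk_norm_le1P; move: cF; rewrite inE.
have Uc : ubound (coef_sums R n d) (F c).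
  move=> _ [f [fd /disk_norm_le1P f1] <-].
  rewrite -(vecK fd); apply: cmax; rewrite inE => z zD.
  by rewrite vecK//; exact: f1.
suff -> : max_coef_sum R n d = F c by [].
apply/eqP; rewrite eq_le; apply/andP; split.
  by apply: ge_sup => //; exists (F c).
by apply: ub_le_sup => //; exists (F c).
Qed.

End Attained.

(* Main.v *)
Require Import Defs.
From mathcomp Require Import all_boot all_order all_algebra.
From mathcomp Require Import complex.
From mathcomp Require Import all_classical all_reals all_analysis.
From mathcomp Require Import zify ring lra cyclic separable cyclotomic.

Set Implicit Arguments.
Unset Strict Implicit.
Unset Printing Implicit Defensive.

Import Order.TTheory GRing.Theory Num.Theory.
Import numFieldNormedType.Exports.
Import ComplexField.Normc.

Local Open Scope ring_scope.

(** The two sides of the estimate both compare [max_coef_sum R n d] with the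
    Landau constant G_n = b_0^2 + ... + b_n^2, where b_k = binom(2k,k) / 4^k are
    the Taylor coefficients of (1 - X)^(-1/2).  The truncation K of that series
    at degree n satisfies K^2 = 1 + X + ... + X^n modulo X^(n+1), so a_0 + ... +
    a_n is the coefficient of X^n in f K^2.

    Upper bound, for every d ([landau_upper_bound]).  The coefficient of X^n of a
    polynomial is the average of its values times z^(-n) over the N-th roots of
    unity, N large.  When |f| <= 1 on the circle, the coefficient of X^n in f K^2
    is therefore at most the average of |K|^2.  On the circle |K(z)|^2 =
    z^(-n) K(z) P(z), where P is K with its coefficients reversed, so this
    average is the coefficient of X^n in K P, that is G_n.

    Lower bound ([landau_almost_extremal]).  Equality would hold for the Blaschke
    product P / K, which is not a polynomial.  Since b_(k+1) / b_k is at most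
    r = 1 - 1/(2n) for k < n, the polynomial (1 - r X) K has the form 1 - W with W
    of nonnegative coefficients and W(1/r) = 1.  The coefficients of 1 / (1 - W)
    then lie between 0 and r^i, and truncating that series at degree D gives a
    polynomial V for which Q = (1 - r X) V satisfies Q K = 1 + O(X^D), the error
    being at most (n + 2) r^D on the circle.  Then P Q has degree less than
    n + 1 + D, modulus at most 1 + (n + 2) r^D in the disk, and its first n + 1
    coefficients add up to G_n.  Dividing by the bound on its modulus costs at
    most (n + 2) r^D G_n; with D = d - n - 1 and d > 16 n log n, r^D is O(n^(-2)),
    so this loss is bounded because G_n <= n + 1.

    Finally G_n = log n / pi + O(1), by the Wallis bounds
    1 / (pi (k + 1)) <= b_k^2 and, for k > 0, b_k^2 <= 1 / (pi k), together with
    the comparison of the harmonic sum with the logarithm. *)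

(** * Taylor coefficients of the inverse square root of 1 - X *)

Section LandauCoefficients.
Variable F : realFieldType.
Implicit Types k m n : nat.

Definition landau_coef k : F := \prod_(i < k) (i.*2.+1%:R / i.*2.+2%:R).

Local Notation b := landau_coef.

Lemma landau_coef0 : b 0 = 1.
Proof. by rewrite /b big_ord0. Qed.

Lemma landau_coefS k : b k.+1 = b k * (k.*2.+1%:R / k.*2.+2%:R).
Proof. by rewrite /b big_ord_recr. Qed.

Lemma landau_coef_rec k : k.*2.+2%:R * b k.+1 = k.*2.+1%:R * b k.
Proof. by rewrite landau_coefS mulrCA [_ * (_ / _)]mulrC divfK ?pnatr_eq0// mulrC. Qed.

Lemma landau_coef_gt0 k : 0 < b k.
Proof. by apply: prodr_gt0 => i _; rewrite divr_gt0 ?ltr0n. Qed.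

Lemma landau_coef_le1 k : b k <= 1.
Proof.
elim: k => [|k IH]; first by rewrite landau_coef0.
rewrite landau_coefS mulr_ile1 ?(ltW (landau_coef_gt0 _)) ?divr_ge0//.
by rewrite ler_pdivrMr ?ltr0n// mul1r ler_nat.
Qed.

(** The square of (1 - X)^(-1/2) is the geometric series.  The recurrence on b
    says that B = sum_k b_k X^k solves 2 (1 - X) B' = B, hence
    (1 - X) (B^2)' = B^2, and this makes the coefficients of B^2 constant. *)
Lemma landau_coef_conv m : \sum_(i < m.+1) b i * b (m - i) = 1.
Proof.
elim: m => [|m IH]; first by rewrite big_ord_recr big_ord0 /= landau_coef0; ring.
pose c k := \sum_(i < k.+1) b i * b (k - i).
(* The coefficient of X B B', taken twice, is that of X (B^2)'. *)
have sym k : 2 * \sum_(i < k.+1) i%:R * (b i * b (k - i)) = k%:R * c k.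
  rewrite (_ : 2 = 1 + 1) // mulrDl mul1r.
  rewrite {1}(reindex_inj rev_ord_inj)/= -big_split mulr_sumr /=.
  apply: eq_bigr => i _; have ik : (i <= k)%N by rewrite -ltnS.
  rewrite subSS subKn// natrB//; ring.
apply: (mulfI (x := m.+1%:R)); first by rewrite pnatr_eq0.
rewrite mulr1 -[LHS]sym big_ord_recl mul0r add0r mulr_sumr.
transitivity (\sum_(i < m.+1) (i.*2.+1%:R * (b i * b (m - i)))).
  apply: eq_bigr => i _; rewrite subSS mulrA -natrM.
  rewrite (_ : 2 * bump 0 i = i.*2.+2)%N; last by rewrite /bump leq0n mul2n doubleS.
  by rewrite mulrA landau_coef_rec mulrA.
rewrite (eq_bigr (fun i : 'I_m.+1 =>
    2 * (i%:R * (b i * b (m - i))) + b i * b (m - i))).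
  by rewrite big_split -mulr_sumr sym /c /= IH mulr1 natr1.
by move=> i _; rewrite -natr1 -mul2n natrM; ring.
Qed.

Definition landau_poly n : {poly F} := \poly_(k < n.+1) b k.
Definition landau_rpoly n : {poly F} := \poly_(k < n.+1) b (n - k).

Lemma coef_landau_poly_sqr n m : (m <= n)%N -> (landau_poly n ^+ 2)`_m = 1.
Proof.
move=> mn; rewrite expr2 coefM -(landau_coef_conv m); apply: eq_bigr => i _.
by rewrite !coef_poly !ltnS (leq_trans (leq_subr _ _) mn) (leq_trans _ mn)// -ltnS.
Qed.

Definition landau_const n : F := \sum_(k < n.+1) b k ^+ 2.

Lemma coef_landau_poly_rpoly n :
  (landau_poly n * landau_rpoly n)`_n = landau_const n.
Proof.
rewrite coefM; apply: eq_bigr => i _; rewrite !coef_poly ltn_ord ltnS leq_subr.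
by rewrite subKn// -ltnS.
Qed.

Lemma landau_const_ge0 n : 0 <= landau_const n.
Proof. by apply: sumr_ge0 => i _; exact: sqr_ge0. Qed.

Lemma landau_const_le n : landau_const n <= n.+1%:R.
Proof.
rewrite -[n.+1%:R](_ : \sum_(i < n.+1) 1 = _); last by rewrite sumr_const card_ord.
by apply: ler_sum => i _; rewrite expr_le1// ?landau_coef_le1// ltW ?landau_coef_gt0.
Qed.

End LandauCoefficients.

(** * Truncated inverses of 1 - W with W nonnegative *)

Section Inverse.
Variable F : realFieldType.

(** The coefficients of 1 / (1 - W) satisfy v_D = sum_k W_k v_(D-k) for D > 0.
    Inductively this is at most r^D W(1/r), so the normalization W(1/r) <= 1
    keeps the sequence below r^D with no loss of constant.  From degree D on, the
    coefficients of (1 - W) V are those of - W V, under the same bound. *)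
Lemma approx_inverse (W : {poly F}) (r : F) D :
    (forall i, 0 <= W`_i) -> W`_0 = 0 -> 0 < r -> W.[r^-1] <= 1 ->
  exists V : {poly F}, [/\ (size V <= D)%N, forall i, 0 <= V`_i <= r ^+ i,
    forall i, (i < D)%N -> ((1 - W) * V)`_i = (i == 0)%:R &
    forall i, (D <= i)%N -> `|((1 - W) * V)`_i| <= r ^+ i].
Proof.
move=> W0 W00 r0 Wr.
have bound (V : {poly F}) i : (forall i, 0 <= V`_i <= r ^+ i) ->
    0 <= (W * V)`_i <= r ^+ i.
  move=> V01; rewrite coefM; apply/andP; split.
    by apply: sumr_ge0 => j _; rewrite mulr_ge0//; case/andP: (V01 (i - j)%N).
  apply: (@le_trans _ _ (r ^+ i * \sum_(j < i.+1) W`_j * r^-1 ^+ j)).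
    rewrite mulr_sumr; apply: ler_sum => j _.
    rewrite [leRHS]mulrCA ler_wpM2l//.
    by rewrite exprVn -expfB_cond ?(gt_eqF r0)//; [case/andP: (V01 (i - j)%N)|rewrite add0n -ltnS].
  rewrite ler_piMr ?exprn_ge0 ?(ltW r0)//; apply: le_trans Wr.
  rewrite (@horner_coef_wide _ (maxn (size W) i.+1)) ?leq_maxl//.
  rewrite (big_ord_widen _ (fun j => W`_j * r^-1 ^+ j) (leq_maxr (size W) i.+1)).
  rewrite big_mkcond; apply: ler_sum => j _.
  by case: ifP => // _; rewrite mulr_ge0// exprn_ge0// invr_ge0 ltW.
suff [V [sV V01 V1]] : exists V : {poly F}, [/\ (size V <= D)%N,
    forall i, 0 <= V`_i <= r ^+ i &
    forall i, (i < D)%N -> ((1 - W) * V)`_i = (i == 0)%:R].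
  exists V; split=> // i Di; rewrite mulrBl mul1r coefB.
  rewrite (nth_default _ (leq_trans sV Di)) sub0r normrN.
  by have /andP[W1 W2] := bound V i V01; rewrite ger0_norm.
elim: D => [|D [V [sV V01 V1]]].
  exists 0; split=> //; first by rewrite size_poly0.
  by move=> i; rewrite coef0 lexx exprn_ge0// ltW.
pose c := (D == 0)%:R + (W * V)`_D.
have c01 : 0 <= c <= r ^+ D.
  rewrite /c; case: D sV V1 @c => [|D] sV V1 /=; last by rewrite add0r; apply: bound.
  by rewrite coef0M W00 mul0r addr0 ler01 lexx.
have VD : V`_D = 0 by rewrite nth_default.
exists (V + c%:P * 'X^D); split.
- rewrite (leq_trans (size_polyD _ _))// geq_max (leq_trans sV)//=.
  by rewrite mul_polyC (leq_trans (size_scale_leq _ _))// size_polyXn.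
- move=> i; rewrite coefD coefCM coefXn; have [->|iD] := eqVneq i D.
    by rewrite VD mulr1 add0r.
  by rewrite mulr0 addr0.
- move=> i; rewrite ltnS leq_eqVlt mulrDr coefD mulrA coefMXn.
  case/orP => [/eqP->|iD]; last by rewrite V1// iD addr0.
  rewrite ltnn subnn mulrBl mul1r coefB VD sub0r mulrBl mul1r coefB coefC eqxx.
  by rewrite coefMC W00 mul0r subr0 addrC addrK.
Qed.

End Inverse.

(** * The Wallis bounds and the size of the Landau constants *)

Section Wallis.
Variable R : realType.
Implicit Types (k m n : nat) (x : R).

Local Notation b := (landau_coef R).

(** The primitive of sin^m vanishing at 0, in the form given by integration by
    parts; its value at pi / 2 is the Wallis integral of exponent m. *)
Fixpoint sin_power_primitive m : R -> R :=
  match m with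
  | 0 => id
  | 1 => cst 1 - cos
  | (m'.+1 as p).+1 =>
      p.+1%:R^-1 \*: (p%:R \*: sin_power_primitive m' - cos * sin ^+ p)
  end.

Local Notation I := sin_power_primitive.

Lemma sin_power_primitiveSS m x :
  I m.+2 x = m.+2%:R^-1 * (m.+1%:R * I m x - cos x * sin x ^+ m.+1).
Proof.
by have -> : sin x ^+ m.+1 = (sin ^+ m.+1 : R -> R) x by rewrite exprfctE.
Qed.

Lemma is_derive_sin_power_primitive m x : is_derive x 1 (I m) (sin x ^+ m).
Proof.
suff: is_derive x 1 (I m) (sin x ^+ m) /\
  is_derive x 1 (I m.+1) (sin x ^+ m.+1) by case.
elim: m => [|m [IH IHS]].
  split; first by rewrite expr0; exact: is_derive_id.
  by apply: is_derive_eq; rewrite sub0r opprK expr1.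
split=> //; apply: is_derive_eq.
rewrite /GRing.scale /= exprfctE; have := cos2Dsin2 x => cs.
apply: (mulfI (x := m.+2%:R)); first by rewrite pnatr_eq0.
rewrite mulVKf ?pnatr_eq0// [cos x * _]mulrC -[_ * cos x * cos x]mulrA -expr2.
have -> : cos x ^+ 2 = 1 - sin x ^+ 2 by rewrite -cs addrK.
by rewrite !exprS -[m.+2%:R]natr1; ring.
Qed.

Lemma sin_power_primitive_at0 m : I m 0 = 0.
Proof.
suff: I m 0 = 0 /\ I m.+1 0 = 0 by case.
elim: m => [|m [IH IHS]]; first by split=> //; rewrite [LHS](_ : _ = 1 - cos 0)// cos0 subrr.
split=> //; rewrite sin_power_primitiveSS IH sin0 expr0n/= !mulr0 subrr mulr0//.
Qed.

(** The difference of the two primitives vanishes at 0 and has the nonnegative derivative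
    sin^m (1 - sin) on the interval. *)
Lemma sin_power_primitive_pihalf_anti m : I m.+1 (pi / 2) <= I m (pi / 2).
Proof.
pose f : R -> R := I m - I m.+1.
have df x : is_derive x 1 f (sin x ^+ m - sin x ^+ m.+1).
  by apply: is_deriveB; exact: is_derive_sin_power_primitive.
have pi0 : 0 <= pi / 2 :> R by rewrite divr_ge0 ?pi_ge0.
suff : f 0 <= f (pi / 2).
  have fE x : f x = I m x - I m.+1 x by [].
  by rewrite !fE !sin_power_primitive_at0 subrr subr_ge0.
apply: (@ger0_derive1_ndecr _ f 0 (pi / 2)) => //.
- move=> x; rewrite in_itv/= => /andP[x0 x1].
  rewrite derive1E derive_val exprS -{1}[_ ^+ m]mul1r -mulrBl.
  rewrite mulr_ge0 ?subr_ge0 ?sin_le1// exprn_ge0// sin_ge0_pi// (ltW x0)/=.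
  by have := pi_gt0 R; lra.
- by apply: derivable_within_continuous => x _; exact: ex_derive.
Qed.

Lemma sin_power_primitive_pihalfSS m :
  I m.+2 (pi / 2) = m.+1%:R / m.+2%:R * I m (pi / 2).
Proof. by rewrite sin_power_primitiveSS cos_pihalf mul0r subr0 mulrCA mulrA. Qed.

Lemma sin_power_primitive_even k : I k.*2 (pi / 2) = pi / 2 * b k.
Proof.
elim: k => [|k IH]; first by rewrite landau_coef0 mulr1.
by rewrite doubleS sin_power_primitive_pihalfSS IH landau_coefS; ring.
Qed.

Lemma sin_power_primitive_odd k : I k.*2.+1 (pi / 2) = (k.*2.+1%:R * b k)^-1.
Proof.
elim: k => [|k IH].
  by rewrite landau_coef0 mulr1 invr1 /= [LHS](_ : _ = 1 - cos (pi / 2))// cos_pihalf subr0.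
rewrite doubleS sin_power_primitive_pihalfSS IH landau_coefS.
by rewrite !invfM invrK; ring.
Qed.

(** The even and odd Wallis integrals are (pi / 2) b_k and
    1 / ((2k + 1) b_k): comparing consecutive ones bounds b_k^2 from both
    sides with the sharp constant 1 / pi. *)
Lemma landau_coef_sqr_ge k : (pi * k.+1%:R)^-1 <= b k ^+ 2.
Proof.
have b0 := landau_coef_gt0 R k; have pi0 := pi_gt0 R.
have := sin_power_primitive_pihalf_anti k.*2.
rewrite sin_power_primitive_even sin_power_primitive_odd.
rewrite -div1r ler_pdivrMr ?mulr_gt0// => h.
rewrite -div1r ler_pdivrMr ?mulr_gt0//; apply: le_trans h _.
rewrite -subr_ge0 (_ : _ - _ = pi / 2 * b k ^+ 2).
  by rewrite mulr_ge0 ?sqr_ge0// divr_ge0// ltW.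
by rewrite -!natr1 -mul2n natrM; field.
Qed.

Lemma landau_coef_sqr_le k : b k.+1 ^+ 2 <= (pi * k.+1%:R)^-1.
Proof.
have b0 := landau_coef_gt0 R k; have pi0 := pi_gt0 R.
have := sin_power_primitive_pihalf_anti k.*2.+1.
rewrite -doubleS sin_power_primitive_even sin_power_primitive_odd.
rewrite -landau_coef_rec -[leRHS]div1r ler_pdivlMr ?mulr_gt0 ?landau_coef_gt0// => h.
rewrite -[leRHS]div1r ler_pdivlMr ?mulr_gt0//; apply: le_trans h.
rewrite -doubleS -mul2n natrM -subr_ge0 (_ : _ - _ = 0)//.
by field.
Qed.

Lemma ln_ge1BV (x : R) : 0 < x -> 1 - x^-1 <= ln x.
Proof.
move=> x0; rewrite -[ln x]opprK lerNr opprB -lnV ?posrE// -[X in ln X](addrNK 1).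
by rewrite [_ - 1 + 1]addrC le_ln1Dx// ltrBDl subrr invr_gt0.
Qed.

Lemma ln_natS k : (0 < k)%N ->
  k.+1%:R^-1 <= ln (k.+1%:R : R) - ln k%:R <= k%:R^-1.
Proof.
move=> k0; have kR : 0 < k%:R :> R by rewrite ltr0n.
rewrite -ln_div ?posrE//; apply/andP; split.
  apply: le_trans (ln_ge1BV _); last by rewrite divr_gt0.
  by rewrite invf_div lerBrDr -[X in X + _]mul1r -mulrDl addrC natr1 divff ?pnatr_eq0.
rewrite -natr1 mulrDl divff ?gt_eqF// mul1r le_ln1Dx//.
by apply: (@lt_trans _ _ 0); rewrite ?oppr_lt0 ?invr_gt0.
Qed.

Lemma landau_const_ge_ln n : ln n.+2%:R / pi <= landau_const R n.
Proof.
have pi0 := pi_gt0 R; rewrite /landau_const.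
elim: n.+1 => [|m IH]; first by rewrite ln1 mul0r big_ord0.
rewrite big_ord_recr /=.
apply: le_trans (lerD IH (landau_coef_sqr_ge m)).
rewrite -lerBlDl -mulrBl invfM mulrC ler_wpM2l ?invr_ge0 ?(ltW pi0)//.
by have /andP[] := @ln_natS m.+1 isT.
Qed.

Lemma landau_const_le_ln n : landau_const R n.+1 <= ln n.+1%:R / pi + 2.
Proof.
have pi0 := pi_gt0 R.
elim: n => [|n IH].
  rewrite ln1 mul0r add0r /landau_const !big_ord_recr big_ord0/= add0r.
  by rewrite lerD// exprn_ile1 ?landau_coef_le1// ltW// landau_coef_gt0.
rewrite /landau_const big_ord_recr -/(landau_const R n.+1) /=.
apply: le_trans (lerD IH (landau_coef_sqr_le n.+1)) _.
rewrite addrAC lerD2r -lerBrDl -mulrBl invfM [leRHS]mulrC ler_wpM2l ?invr_ge0 ?(ltW pi0)//.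
by have /andP[] := @ln_natS n.+1 isT.
Qed.

End Wallis.

(** * Coefficients as averages over roots of unity *)

Section RootsOfUnity.

Lemma numClosed_prim_root (C : numClosedFieldType) N :
  (0 < N)%N -> exists w : C, N.-primitive_root w.
Proof.
move=> N0; have [r] := closed_field_poly_normal ('X^N - 1 : {poly C}).
rewrite (monicP _) ?monicXnsubC// scale1r => rE.
have /hasP[w _ wN] : has N.-primitive_root r.
  apply: (has_prim_root N0).
  - by apply/allP => z; rewrite -root_prod_XsubC -rE.
  - by rewrite -separable_prod_XsubC -rE separable_Xn_sub_1// pnatr_eq0 -lt0n.
  - by rewrite -ltnS -(size_prod_XsubC r id) -rE size_XnsubC.
by exists w.
Qed.

(** Finite Fourier inversion; it replaces Cauchy's integral formula. *)
Lemma coef_prim_root_sum (F : fieldType) N (w : F) (p : {poly F}) k :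
    N.-primitive_root w -> (size p <= N)%N -> (k < N)%N ->
  N%:R * p`_k = \sum_(j < N) p.[w ^+ j] * (w ^+ j)^-1 ^+ k.
Proof.
move=> wN pN kN; have N0 := leq_ltn_trans (leq0n k) kN.
have w0 : w != 0.
  by apply: contra_eqN (prim_expr_order wN) => /eqP->; rewrite expr0n gtn_eqF// eq_sym oner_eq0.
under eq_bigr do rewrite (horner_coef_wide _ pN) mulr_suml.
rewrite exchange_big (bigD1 (Ordinal kN))//= [X in _ + X]big1 ?addr0 => [|i ik].
  rewrite mulr_natl -[N in LHS]card_ord -sumr_const; apply: eq_bigr => j _.
  by rewrite -mulrA -exprMn divff ?expr1n ?mulr1// expf_neq0.
(* The terms of index i <> k form a geometric sum of ratio u, with u^N = 1. *)
pose u := w ^+ i / w ^+ k.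
have u1 : u != 1.
  rewrite -[1](divff (expf_neq0 k w0)) (inj_eq (mulIf _)) ?invr_eq0 ?expf_neq0//.
  by rewrite (eq_prim_root_expr wN) !modn_small.
have uN : u ^+ N = 1.
  by rewrite exprMn exprVn -!exprM ![(_ * N)%N]mulnC !exprM (prim_expr_order wN) !expr1n divr1.
have : (u - 1) * \sum_(j < N) u ^+ j = 0 by rewrite -subrX1 uN subrr.
move/eqP; rewrite mulf_eq0 subr_eq0 (negPf u1) => /eqP u0.
transitivity (p`_i * \sum_(j < N) u ^+ j); last by rewrite u0 mulr0.
rewrite mulr_sumr; apply: eq_bigr => j _.
by rewrite -mulrA /u exprMn !exprVn -!exprM ![(j * _)%N]mulnC.
Qed.

End RootsOfUnity.

(** * Polynomials bounded on the circle and on the disk *)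

Section Circle.
Variable R : realType.
Implicit Types (p f : {poly R[i]}) (z : R[i]) (n k : nat).

Lemma normcX z k : normc (z ^+ k) = normc z ^+ k.
Proof. by elim: k => [|k IH]; rewrite ?normc1// !exprS normcM IH. Qed.

Lemma normc_real (x : R) : normc (x%:C)%C = `|x|.
Proof. by rewrite /= expr0n/= addr0 sqrtr_sqr. Qed.

Lemma mul_conjc z : z * (z^*)%C = ((normc z ^+ 2)%:C)%C.
Proof. by rewrite -sqr_normc normc_def rmorphXn /=; case: z. Qed.

Lemma normc_horner_le p z :
  normc z <= 1 -> normc p.[z] <= \sum_(i < size p) normc p`_i.
Proof.
move=> z1; rewrite horner_coef; apply: le_trans (le_normc_sum _ _) _.
apply: ler_sum => i _; rewrite normcM normcX ler_piMr ?normc_ge0//.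
by rewrite exprn_ile1 ?normc_ge0.
Qed.

Lemma normc_prim_root N (w : R[i]) : N.-primitive_root w -> normc w = 1.
Proof.
move=> wN; apply/eqP; rewrite -(@pexpr_eq1 _ _ N) ?normc_ge0 ?(prim_order_gt0 wN)//.
by rewrite -normcX (prim_expr_order wN) normc1.
Qed.

Lemma normc_coef_le p k (M : R) :
  (forall z, normc z = 1 -> normc p.[z] <= M) -> normc p`_k <= M.
Proof.
move=> pM; pose N := maxn (size p) k.+1.
have kN : (k < N)%N by rewrite leq_maxr.
have N0 : (0 < N)%N by exact: leq_ltn_trans kN.
have [w wN] := numClosed_prim_root (R[i]) N0.
have w1 j : normc (w ^+ j) = 1 by rewrite normcX (normc_prim_root wN) expr1n.
have N0R : 0 < N%:R :> R by rewrite ltr0n.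
rewrite -(ler_pM2l N0R).
have -> : N%:R * normc p`_k = normc (N%:R * p`_k).
  by rewrite normcM -(rmorph_nat (real_complex R)) normc_real normr_nat.
rewrite (coef_prim_root_sum wN (leq_maxl _ _) kN).
apply: le_trans (le_normc_sum _ _) _.
rewrite mulr_natl -[N in leRHS]card_ord -sumr_const.
apply: ler_sum => j _; rewrite normcM normcX normcV w1 invr1 expr1n mulr1.
exact: pM.
Qed.

Lemma le1_of_bounded_exprn (x B : R) : 0 <= x -> (forall m, x ^+ m <= B) -> x <= 1.
Proof.
move=> x0 xB; rewrite leNgt; apply/negP => x1.
have d0 : 0 < x - 1 by rewrite subr_gt0.
have bern m : 1 + (x - 1) *+ m <= x ^+ m.
  elim: m => [|m IH]; first by rewrite mulr0n addr0.
  rewrite exprS; apply: (le_trans _ (ler_wpM2l x0 IH)).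
  rewrite -subr_ge0 (_ : _ - _ = (x - 1) ^+ 2 *+ m) ?mulrn_wge0 ?sqr_ge0//.
  by rewrite mulrS -[(x - 1) *+ m]mulr_natr -[_ ^+ 2 *+ m]mulr_natr; ring.
have B0 : 0 <= B by apply: le_trans (xB 0%N); rewrite expr0.
have := archi_boundP (divr_ge0 B0 (ltW d0)); set m := Num.bound _.
rewrite ltr_pdivrMr// mulr_natl => mB.
have := le_lt_trans (le_trans (bern m) (xB m)) mB.
by rewrite gtrDr ltr10.
Qed.

(** Every coefficient of p^m is at most 1 in modulus, so |p(z)|^m is at most
    1 / (1 - |z|) for all m, which forces |p(z)| <= 1. *)
Lemma maximum_principle p z :
  (forall z, normc z = 1 -> normc p.[z] <= 1) -> normc z < 1 -> normc p.[z] <= 1.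
Proof.
move=> p1 z1; pose r := normc z; have r0 : 0 <= r := normc_ge0 z.
have r1 : 0 < 1 - r by rewrite subr_gt0.
apply: (@le1_of_bounded_exprn _ (1 - r)^-1) => [|m]; first exact: normc_ge0.
have pm1 k : normc (p ^+ m)`_k <= 1.
  apply: normc_coef_le => y y1; rewrite horner_exp normcX.
  by rewrite exprn_ile1 ?normc_ge0 ?p1.
rewrite -normcX -horner_exp horner_coef.
apply: le_trans (le_normc_sum _ _) _.
apply: (@le_trans _ _ (\sum_(i < size (p ^+ m)) r ^+ i)).
  by apply: ler_sum => i _; rewrite normcM normcX ler_piMl ?exprn_ge0.
rewrite -[leRHS]div1r ler_pdivlMr// mulrC -opprB mulNr -subrX1 opprB.
by rewrite gerDl oppr_le0 exprn_ge0.
Qed.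

(** Along the radius, p(z) - p(y) = (z - y) q(y) with q bounded on the disk, so
    p(z) is a limit of values of p inside the disk. *)
Lemma circle_bound p z :
  (forall z, normc z < 1 -> normc p.[z] <= 1) -> normc z = 1 -> normc p.[z] <= 1.
Proof.
move=> p1 z1.
have /factor_theorem[q pq] : root (p - p.[z]%:P) z.
  by rewrite rootE hornerD hornerN hornerC subrr.
pose L := \sum_(i < size q) normc q`_i.
have L0 : 0 <= L by apply: sumr_ge0 => i _; exact: normc_ge0.
apply/ler_addgt0Pr => e e0.
pose d := Num.min 1 (e / (L + 1)).
have L1 : 0 < L + 1 by rewrite ltr_wpDl.
have d0 : 0 < d by rewrite lt_min ltr01 divr_gt0.
have d1 : d <= 1 by rewrite ge_min lexx.
have dL : d * L <= e.
  apply: (@le_trans _ _ (e / (L + 1) * (L + 1))); last by rewrite divfK ?gt_eqF.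
  by rewrite ler_pM ?(ltW d0) ?lerDl// ge_min lexx orbT.
pose y := ((1 - d)%:C)%C * z.
have y1 : normc y = 1 - d by rewrite normcM z1 mulr1 normc_real ger0_norm ?subr_ge0.
have -> : p.[z] = p.[y] - (p - p.[z]%:P).[y].
  by rewrite hornerD hornerN hornerC opprB addrC subrK.
apply: le_trans (le_normcD _ _) _; apply: lerD.
  by apply: p1; rewrite y1 gtrBl.
rewrite normcN pq hornerM normcM hornerXsubC.
have -> : y - z = ((- d)%:C)%C * z.
  rewrite /y -[X in _ - X]mul1r -mulrBl -[X in _ - X](rmorph1 (real_complex R)).
  by rewrite -rmorphB addrAC subrr add0r.
rewrite normcM z1 mulr1 normc_real normrN gtr0_norm// mulrC.
apply: le_trans dL; rewrite ler_wpM2l ?(ltW d0)//.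
by apply: normc_horner_le; rewrite y1 gerBl ltW.
Qed.

End Circle.

(** * The extremal problem and the Landau constant *)

Section Bounds.
Variable R : realType.
Implicit Types (z : R[i]) (n D : nat).

Local Notation toC := (real_complex R).
Local Notation K n := (map_poly toC (landau_poly R n)).
Local Notation P n := (map_poly toC (landau_rpoly R n)).

Lemma conjc_horner_real (p : {poly R}) z :
  ((map_poly toC p).[z]^*)%C = (map_poly toC p).[z^*%C].
Proof.
rewrite -horner_map -map_poly_comp; congr _.[_].
by apply: eq_map_poly => x; exact: conjc_real.
Qed.

(** Conjugation inverts the points of the circle and fixes the real
    coefficients, so it turns K into its reversal up to the factor z^n. *)
Lemma landau_rpoly_horner n z : normc z = 1 ->
  (P n).[z] = z ^+ n * (((K n).[z])^*)%C.
Proof.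
move=> z1; have zz : z * (z^*)%C = 1 by rewrite mul_conjc z1 expr1n.
rewrite conjc_horner_real /landau_poly /landau_rpoly.
have sz (c : nat -> R) : (size (map_poly toC (\poly_(k < n.+1) c k)) <= n.+1)%N.
  by rewrite (leq_trans (size_poly _ _))// size_poly.
rewrite !(horner_coef_wide _ (sz _)) (reindex_inj rev_ord_inj)/= mulr_sumr.
apply: eq_bigr => i _; have ik : (i <= n)%N by rewrite -ltnS.
rewrite !coef_map !coef_poly subSS ltnS leq_subr ltn_ord subKn// mulrCA; congr (_ * _).
have -> : z ^+ n = z ^+ (n - i) * z ^+ i by rewrite -exprD subnK.
by rewrite -mulrA -exprMn zz expr1n mulr1.
Qed.

Lemma normc_landau_rpoly n z : normc z = 1 -> normc (P n).[z] = normc (K n).[z].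
Proof.
move=> z1; rewrite landau_rpoly_horner// normcM normcX z1 expr1n mul1r.
by case: (K n).[z] => a c; rewrite /= sqrrN.
Qed.

Lemma mul_landau_poly_rpoly n z : normc z = 1 ->
  (K n * P n).[z] * z^-1 ^+ n = ((normc (K n).[z] ^+ 2)%:C)%C.
Proof.
move=> z1; have z0 : z != 0.
  by apply/eqP => z0; move: z1; rewrite z0 normc0 => /esym/eqP; rewrite oner_eq0.
rewrite hornerM landau_rpoly_horner// exprVn -mul_conjc mulrCA -mulrA mulrC.
by rewrite mulfVK ?expf_neq0.
Qed.

(** Landau's inequality: the sum is the coefficient of X^n in f K^2, an average
    of values of modulus at most |K|^2. *)
Lemma landau_upper_bound n (f : {poly R[i]}) :
    (forall z, normc z = 1 -> normc f.[z] <= 1) ->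
  normc (\sum_(i < n.+1) f`_i) <= landau_const R n.
Proof.
move=> f1.
have -> : \sum_(i < n.+1) f`_i = (f * K n ^+ 2)`_n.
  rewrite coefM; apply: eq_bigr => i _.
  rewrite -rmorphXn coef_map coef_landau_poly_sqr ?leq_subr//.
  by rewrite mulr1.
(* N exceeds all degrees in play, so that nothing is aliased. *)
pose N := (maxn (maxn (size (f * K n ^+ 2)) (size (K n * P n))) n.+1).
have nN : (n < N)%N by rewrite leq_maxr.
have N0 : (0 < N)%N by exact: leq_ltn_trans nN.
have [w wN] := numClosed_prim_root (R[i]) N0.
have w1 j : normc (w ^+ j) = 1 by rewrite normcX (normc_prim_root wN) expr1n.
have N0R : 0 < N%:R :> R by rewrite ltr0n.
have normN z : N%:R * normc z = normc (N%:R * z).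
  by rewrite normcM -(rmorph_nat toC) normc_real normr_nat.
rewrite -(ler_pM2l N0R) normN (coef_prim_root_sum wN _ nN); last by rewrite !leq_max leqnn.
apply: le_trans (le_normc_sum _ _) _.
apply: (@le_trans _ _ (\sum_(j < N) normc (K n).[w ^+ j] ^+ 2)).
  apply: ler_sum => j _; rewrite hornerM horner_exp !normcM !normcX normcV w1.
  rewrite invr1 expr1n mulr1; apply: ler_piMl; first exact: sqr_ge0.
  exact: f1.
rewrite le_eqVlt; apply/orP; left; rewrite -(inj_eq (@complexI R)) rmorph_sum/=.
rewrite (eq_bigr (fun j : 'I_N => (K n * P n).[w ^+ j] * (w ^+ j)^-1 ^+ n)); last first.
  by move=> j _; rewrite mul_landau_poly_rpoly.
rewrite -(coef_prim_root_sum wN _ nN); last by rewrite !leq_max leqnn orbT.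
by rewrite -rmorphM coef_map coef_landau_poly_rpoly rmorphM rmorph_nat.
Qed.

(** Since b_(k+1) / b_k <= 1 - 1/(2n) for k < n, the zeros of K have modulus at
    least the inverse of this number (Enestrom-Kakeya). *)
Definition decay_rate n : R := 1 - (n.*2%:R)^-1.

(** The truncation of the Blaschke product P / K, with 1 / K replaced by
    Q = (1 - r X) V.  Only |P| = |K| on the circle and Q K = 1 + O(X^D) matter:
    the first gives |P Q| = |K Q|, the second gives the coefficient sum. *)
Lemma landau_almost_extremal n D : (0 < n)%N -> (n < D)%N ->
  exists f : {poly R}, [/\ (size f <= n.+1 + D)%N,
    \sum_(i < n.+1) f`_i = landau_const R n &
    forall z, normc z = 1 ->
      normc (map_poly toC f).[z] <= 1 + n.+2%:R * decay_rate n ^+ D].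
Proof.
move=> n0 nD; set r := decay_rate n.
have n2 : 2 <= n.*2%:R :> R by rewrite ler_nat -(leq_double 1) in n0 *.
have r0 : 0 < r.
  rewrite subr_gt0 invf_lt1; last exact: lt_le_trans n2.
  by apply: lt_le_trans n2; rewrite ltr1n.
have r1 : r <= 1 by rewrite gerBl invr_ge0.
pose L : {poly R} := 1 - r *: 'X.
pose W := 1 - L * landau_poly R n.
have WE i : W`_i = (i == 0)%:R - (landau_poly R n)`_i
    + (if i is j.+1 then r * (landau_poly R n)`_j else 0).
  rewrite /W /L mulrBl mul1r !coefB coef1 -scalerAl coefZ coefXM.
  by case: i => [|i] /=; rewrite ?mulr0; ring.
have W00 : W`_0 = 0 by rewrite WE /= coef_poly /= landau_coef0 addr0 subrr.
have W0 i : 0 <= W`_i.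
  case: i => [|i]; first by rewrite W00.
  rewrite WE sub0r addrC subr_ge0 !coef_poly ltnS.
  have b0 := landau_coef_gt0 R i.
  have [iN|Ni] := ltnP i n; last by rewrite mulr_ge0 ?(ltW r0)//; case: ifP => // _; exact: ltW.
  rewrite ltnW // landau_coefS mulrC ler_pM2r//.
  have -> : i.*2.+1%:R / i.*2.+2%:R = 1 - i.*2.+2%:R^-1 :> R.
    by rewrite -[X in X / _ = _](addrK 1) natr1 mulrBl divff ?pnatr_eq0// mul1r.
  by rewrite lerD2l lerN2 lef_pV2 ?posrE ?ltr0n ?double_gt0// ler_nat -doubleS leq_double.
(* The factor 1 - r X vanishes at 1/r, so the value is exactly 1. *)
have Wr : W.[r^-1] <= 1.
  by rewrite /W /L hornerD hornerN hornerM !hornerE mulfV ?gt_eqF// subrr mul0r subr0.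
have [V [sV _ V1 Vr]] := approx_inverse D W0 W00 r0 Wr.
have E : 1 - W = L * landau_poly R n by rewrite /W opprB addrC subrK.
have sL : (size L <= 2)%N.
  rewrite (leq_trans (size_polyD _ _))// geq_max size_poly1/= size_polyN.
  by rewrite (leq_trans (size_scale_leq _ _))// size_polyX.
have sK : (size (landau_poly R n) <= n.+1)%N by exact: size_poly.
have sP : (size (landau_rpoly R n) <= n.+1)%N by exact: size_poly.
exists (landau_rpoly R n * (L * V)); split.
- rewrite (leq_trans (size_polyMleq _ _))// -subn1 leq_subLR add1n -addnS leq_add//.
  rewrite (leq_trans (size_polyMleq _ _))// -subn1 leq_subLR add1n.
  exact: leq_add sL sV.
- transitivity (((1 - W) * V * (landau_poly R n * landau_rpoly R n))`_n).
    rewrite E.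
    have -> : L * landau_poly R n * V * (landau_poly R n * landau_rpoly R n) =
      landau_rpoly R n * (L * V) * landau_poly R n ^+ 2 by ring.
    rewrite [RHS]coefM; apply: eq_bigr => i _.
    by rewrite coef_landau_poly_sqr ?leq_subr// mulr1.
  rewrite coefM big_ord_recl V1 ?(leq_ltn_trans _ nD)// mul1r subn0.
  rewrite coef_landau_poly_rpoly big1 ?addr0// => i _.
  by rewrite V1 ?mul0r//; exact: leq_ltn_trans (ltn_ord i) nD.
- move=> z z1.
  have -> : normc (map_poly toC (landau_rpoly R n * (L * V))).[z] =
      normc (map_poly toC ((1 - W) * V)).[z].
    by rewrite E !rmorphM !hornerM !normcM normc_landau_rpoly// mulrCA mulrA.
  have sE : (size (map_poly toC ((1 - W) * V)) <= D + n.+2)%N.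
    apply: leq_trans (size_poly _ _) _; rewrite E.
    apply: leq_trans (size_polyMleq _ _) _; apply: leq_trans (leq_pred _) _.
    rewrite addnC; apply: leq_add => //.
    rewrite (leq_trans (size_polyMleq _ _))// -subn1 leq_subLR add1n.
    exact: leq_add sL sK.
  rewrite (horner_coef_wide _ sE); apply: le_trans (le_normc_sum _ _) _.
  rewrite (eq_bigr (fun i : 'I_(D + n.+2) => `|((1 - W) * V)`_i|)) => [|i _]; last first.
    by rewrite normcM normcX z1 expr1n mulr1 coef_map [LHS]normc_real.
  rewrite big_split_ord /=; apply: lerD.
    rewrite (eq_bigr (fun i : 'I_D => (val i == 0)%:R)) => [|i _].
      by case: (D) nD => // D' _; rewrite big_ord_recl big1 ?addr0.
    by rewrite V1// ger0_norm.
  rewrite mulr_natl -[n.+2 in leRHS]card_ord -sumr_const.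
  apply: ler_sum => i _; apply: le_trans (Vr _ (leq_addr _ _)) _.
  by rewrite exprD ler_piMr ?exprn_ile1 ?exprn_ge0// ltW.
Qed.

End Bounds.

(** * Comparison with the logarithm *)

Section Asymptotics.
Variable R : realType.
Implicit Types n d D : nat.

(** By 1 - x <= exp (-x) at x = 1/(2n), the power is at most exp (- D/(2n)),
    and the hypothesis on D makes this at most exp (1 - 8 log n). *)
Lemma decay_rate_exprn_le n D : (0 < n)%N ->
  16 * n%:R * ln n%:R <= (D + n.*2)%:R :> R ->
  decay_rate R n ^+ D <= expR 1 / n%:R ^+ 2.
Proof.
move=> n0 Dn; have nR : 0 < n%:R :> R by rewrite ltr0n.
have ln0 : 0 <= ln n%:R :> R by rewrite ln_ge0// ler1n.
have n2 : n.*2%:R = 2 * n%:R :> R by rewrite -mul2n natrM.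
have r0 : 0 <= decay_rate R n.
  by rewrite subr_ge0 invf_le1 ?n2 -?n2 ?ltr0n ?ler1n ?double_gt0.
have -> : expR 1 / n%:R ^+ 2 = expR (1 - 2 * ln n%:R) :> R.
  by rewrite expRD expRN expRM_natl lnK// posrE.
apply: (@le_trans _ _ (expR (- n.*2%:R^-1) ^+ D)).
  by rewrite lerXn2r ?nnegrE ?expR_ge0//; exact: expR_ge1Dx.
rewrite -expRM_natl ler_expR mulrN lerNl opprB n2 ler_pdivlMr ?mulr_gt0//.
move: Dn; rewrite natrD n2; nra.
Qed.

Lemma max_coef_sum_le n d : max_coef_sum R n d <= landau_const R n.
Proof.
have [[f [_ /disk_norm_le1P f1] <-] _] := max_coef_sumP R n d.
by apply: landau_upper_bound => z; exact: circle_bound.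
Qed.

(** Dividing the almost extremal polynomial by its bound 1 + e makes it
    admissible; this costs at most e G_n, and e G_n <= (n + 2) (n + 1) exp(1) / n^2
    is bounded. *)
Lemma max_coef_sum_ge n d : (1 < n)%N ->
  16 * n%:R * ln n%:R < d%:R :> R ->
  landau_const R n - 6 * expR 1 <= max_coef_sum R n d.
Proof.
move=> n1 dn; have n0 : (0 < n)%N by exact: ltnW.
have nR : 0 < n%:R :> R by rewrite ltr0n.
have nd : (8 * n < d)%N.
  rewrite -(ltr_nat R); apply: le_lt_trans dn.
  have : 2^-1 <= ln n%:R :> R.
    apply: le_trans (ln_ge1BV nR); rewrite lerBrDr -lerBrDl.
    rewrite (_ : 1 - 2^-1 = 2^-1); last by field.
    by rewrite lef_pV2 ?posrE// ler_nat.
  by rewrite natrM; nra.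
(* The almost extremal polynomial has size at most n + 1 + D = d. *)
pose D := (d - n.+1)%N.
have dE : (n.+1 + D = d)%N by rewrite subnKC//; lia.
have nD : (n < D)%N by lia.
have [f [sf fn fz]] := @landau_almost_extremal R n D n0 nD.
pose e : R := n.+2%:R * decay_rate R n ^+ D.
have rD : decay_rate R n ^+ D <= expR 1 / n%:R ^+ 2.
  apply: decay_rate_exprn_le => //; apply: (le_trans (ltW dn)).
  by rewrite ler_nat; lia.
have r0 : 0 <= decay_rate R n.
  by rewrite subr_ge0 invf_le1 ?ltr0n ?ler1n ?double_gt0.
have e0 : 0 <= e by rewrite mulr_ge0// exprn_ge0.
have eG : e * landau_const R n <= 6 * expR 1.
  have G := landau_const_le R n; have G0 := landau_const_ge0 R n.
  apply: (@le_trans _ _ ((n.+2%:R * (expR 1 / n%:R ^+ 2)) * n.+1%:R)).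
    by rewrite ler_pM// ler_wpM2l.
  rewrite (_ : _ * _ = n.+2%:R * n.+1%:R / n%:R ^+ 2 * expR 1); last by ring.
  rewrite ler_wpM2r ?expR_ge0// ler_pdivrMr ?exprn_gt0//.
  by rewrite -natrX -!natrM ler_nat; nia.
have e1 : 0 < 1 + e by rewrite ltr_wpDr.
have [_ ub] := max_coef_sumP R n d.
have in_sums : coef_sums R n d ((1 + e)^-1 * landau_const R n).
  exists (map_poly (real_complex R) ((1 + e)^-1 *: f)).
    split.
      rewrite -dE; apply: leq_trans sf; apply: leq_trans (size_poly _ _) _.
      exact: size_scale_leq.
    apply/disk_norm_le1P => z; apply: maximum_principle => {}z z1.
    rewrite map_polyZ hornerZ normcM [X in X * _]normc_real.
    by rewrite gtr0_norm ?invr_gt0// mulrC ler_pdivrMr// mul1r fz.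
  rewrite (eq_bigr (fun i : 'I_n.+1 => real_complex R ((1 + e)^-1 * f`_i))).
    rewrite -rmorph_sum -mulr_sumr fn /= [LHS]normc_real ger0_norm//.
    by rewrite mulr_ge0 ?landau_const_ge0// invr_ge0 ltW.
  by move=> i _; rewrite coef_map coefZ.
apply: le_trans (ub _ in_sums).
rewrite [leRHS]mulrC ler_pdivlMr//.
have := expR_ge0 (1 : R); nra.
Qed.

End Asymptotics.

Theorem corollary2p2 (R : realType) :
  exists (C : R) (N : nat), 0 < C /\ (1 <= N)%N /\
    forall n d : nat, (N <= n)%N -> 16 * n%:R * ln (n%:R : R) < d%:R ->
      `|max_coef_sum R n d - ln n%:R / pi| <= C.
Proof.
have e0 := expR_gt0 (1 : R).
exists (2 + 6 * expR 1), 2%N; split; first by rewrite addr_gt0// mulr_gt0.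
split=> // n d n2 dn.
have lower := max_coef_sum_ge n2 dn; have upper := max_coef_sum_le R n d.
have ge_ln := landau_const_ge_ln R n.
have le_ln : landau_const R n <= ln n%:R / pi + 2.
  by case: n n2 {dn lower upper ge_ln} => // n _; exact: landau_const_le_ln.
have ln_mono : ln n%:R / pi <= ln n.+2%:R / pi :> R.
  by rewrite ler_pM2r ?invr_gt0 ?pi_gt0// ler_ln ?posrE ?ltr0n ?ler_nat//; lia.
by rewrite ler_norml; apply/andP; split; lra.
Qed.
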